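(* Consider the inexact Rayleigh quotient iteration with MINRES for a Hermitian matrix $A$ described in the context, with unit vectors $e_k,f_k$ and angles $\phi_k,\psi_k$ defined there. Define the angle $\varphi_k=\angle(f_k,(A-\theta_kI)e_k)$ and assume that $$|\cos\varphi_k|\ge|\cos\varphi|>0$$ holds uniformly for an angle $\varphi$ away from $\frac{\pi}{2}$ independent of $k$, i.e., $$|f_k^*(A-\theta_kI)e_k|=\|(A-\theta_kI)e_k\|\,|\cos\varphi_k|\ge\|(A-\theta_kI)e_k\|\,|\cos\varphi|.$$ Then $$\sin\psi_k\le\frac{2\beta}{|\cos\varphi|}\sin\phi_k,\qquad \cos\psi_k=\pm\bigl(1-O(\sin^2\phi_k)\bigr).$$ Furthermore, provided $\xi_k>\sin\phi_k$, $$\cos\psi_k=-1+O(\sin^2\phi_k),\qquad d_k=-x+O(\sin\phi_k).$$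
   Context: Setting. $A\in\mathbb{C}^{n\times n}$ is Hermitian with eigenvalues $\lambda=\lambda_1,\lambda_2,\ldots,\lambda_n$ and corresponding orthonormal eigenvectors $x=x_1,x_2,\ldots,x_n$; $(\lambda,x)$ is the desired eigenpair. $\lambda_{\min},\lambda_{\max}$ are the smallest and largest eigenvalues of $A$, $\|\cdot\|$ is the Euclidean norm, and $$\beta=\frac{\lambda_{\max}-\lambda_{\min}}{|\lambda_2-\lambda|}.$$ Inexact Rayleigh quotient iteration (RQI) with MINRES: given a unit vector $u_k$, put $\theta_k=u_k^*Au_k$; apply $m>1$ steps of MINRES with zero initial guess to $(A-\theta_kI)w=u_k$, i.e. let $w_{k+1}$ minimize $\|(A-\theta_kI)w-u_k\|$ over $w$ in the Krylov subspace $\mathcal{K}_m(A,u_k)=\mathrm{span}\{u_k,Au_k,\ldots,A^{m-1}u_k\}$. Write $$(A-\theta_kI)w_{k+1}=u_k+\xi_kd_k,\qquad \|d_k\|=1,\ \xi_k>0,$$ where $\xi_k\le1$ is the (relative) residual norm and $d_k$ the residual direction; then set $u_{k+1}=w_{k+1}/\|w_{k+1}\|$. Standing assumption: $u_k$ is a reasonably good approximation to $x$ in the sense that, for every $k$ considered, $|\lambda-\theta_k|<|\lambda_2-\theta_k|\le\cdots\le|\lambda_n-\theta_k|$ and $|\lambda-\theta_k|<\tfrac12|\lambda-\lambda_2|$. Angles: $\phi_k=\angle(u_k,x)$ is the acute angle between $u_k$ and $x$, and $\psi_k=\angle(d_k,x)\in[0,\pi]$; one writes the orthogonal decompositions $u_k=x\cos\phi_k+e_k\sin\phi_k$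 with $e_k\perp x$, $\|e_k\|=1$, and $d_k=x\cos\psi_k+f_k\sin\psi_k$ with $f_k\perp x$, $\|f_k\|=1$ (the coefficients along $x$ being taken real). $O(\cdot)$ is as $\sin\phi_k\to0$, with constants independent of $k$. *)

(* Defs.v *)
(* Complex vectors and matrices have entries in R[i] for an arbitrary R : realType;
   norms, angles and eigenvalues are elements of R. *)
From mathcomp Require Import all_boot all_order all_algebra.
From mathcomp Require Import complex.
From mathcomp Require Import classical_sets reals trigo.

Set Implicit Arguments.
Unset Strict Implicit.
Unset Printing Implicit Defensive.

Import Order.TTheory GRing.Theory Num.Theory.
Local Open Scope ring_scope.
Local Open Scope complex_scope.
Local Open Scope sesquilinear_scope.

Section EuclideanSpace.
Variables (R : realType) (n : nat).
Implicit Types v w : 'cV[R[i]]_n.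

(* Conjugate-linear in the first argument. *)
Definition cdot v w : R[i] := (v ^t* *m w) 0 0.

Definition norm2 v : R := Num.sqrt (complex.Re (cdot v v)).

(* Angle in [0, pi]; used when the inner product is real. *)
Definition angle v w : R :=
  acos (complex.Re (cdot v w) / (norm2 v * norm2 w)).

(* Angle in [0, pi/2] between the complex lines spanned by v and w. *)
Definition acute_angle v w : R :=
  acos (complex.Re `|cdot v w| / (norm2 v * norm2 w)).

Definition orthogonal_decomposition (x y : 'cV[R[i]]_n) (t : R) e : Prop :=
  [/\ cdot x e = 0, norm2 e = 1 & y = (cos t)%:C *: x + (sin t)%:C *: e].

End EuclideanSpace.

Section Eigenvalues.
Variables (R : realType) (n : nat).
Implicit Types (A : 'M[R[i]]_n.+2) (lam : 'I_n.+2 -> R).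

Definition orthonormal_eigenbasis A lam (X : 'I_n.+2 -> 'cV[R[i]]_n.+2) : Prop :=
  (forall i, A *m X i = (lam i)%:C *: X i) /\
  (forall i j, cdot (X i) (X j) = (i == j)%:R).

(* Indices start at 0: the target eigenvalue is lam ord0, and the second one
   in the enumeration is lam ord_second. *)
Definition ord_second : 'I_n.+2 := lift ord0 ord0.

Definition lam_min lam : R := \big[Num.min/lam ord0]_i lam i.
Definition lam_max lam : R := \big[Num.max/lam ord0]_i lam i.

Definition spread_ratio lam : R :=
  (lam_max lam - lam_min lam) / `|lam ord_second - lam ord0|.

Definition good_approximation lam (theta : R) : Prop :=
  [/\ `|lam ord0 - theta| < `|lam ord_second - theta|,
      forall i j : 'I_n.+2, (0 < i)%N -> (i <= j)%N ->
        `|lam i - theta| <= `|lam j - theta|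
    & `|lam ord0 - theta| < 2^-1 * `|lam ord0 - lam ord_second|].

End Eigenvalues.

Section InexactRQI.
Variables (R : realType) (n : nat).
Implicit Types (A : 'M[R[i]]_n) (u w : 'cV[R[i]]_n).

(* Real part only to land in R: u^* A u is real when A is Hermitian. *)
Definition rayleigh A u : R := complex.Re (cdot u (A *m u)).

Definition shifted A (theta : R) : 'M[R[i]]_n := A - (theta%:C)%:M.

Definition krylov (m : nat) A u : {vspace 'cV[R[i]]_n} :=
  <<mkseq (fun j => A ^+ j *m u) m>>%VS.

Definition minres_solution A (theta : R) u (m : nat) w : Prop :=
  w \in krylov m A u /\
  forall v, v \in krylov m A u ->
    norm2 (shifted A theta *m w - u) <= norm2 (shifted A theta *m v - u).

(* w k is the vector computed in the k-th outer step, from which u k.+1 is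
   obtained by normalization. Since 0^-1 = 0, an iteration that breaks down
   with w k = 0 is continued by null vectors. *)
Definition inexact_rqi_minres A (m : nat) (u w : nat -> 'cV[R[i]]_n) : Prop :=
  norm2 (u 0%N) = 1 /\
  forall k, minres_solution A (rayleigh A (u k)) (u k) m (w k) /\
            u k.+1 = ((norm2 (w k))^-1)%:C *: w k.

(* xi and d are the norm and the direction of the MINRES residual. *)
Definition minres_residual A (theta : R) u w (xi : R) (d : 'cV[R[i]]_n) : Prop :=
  [/\ norm2 d = 1, 0 < xi & shifted A theta *m w = u + xi%:C *: d].

End InexactRQI.

(* Main.v *)
Require Import Defs.
From mathcomp Require Import all_boot all_order all_algebra.
From mathcomp Require Import complex.
From mathcomp Require Import classical_sets reals trigo.
From mathcomp Require Import ring lra.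

Set Implicit Arguments.
Unset Strict Implicit.
Unset Printing Implicit Defensive.

Import Order.TTheory GRing.Theory Num.Theory.
Local Open Scope ring_scope.
Local Open Scope complex_scope.

(** Write [S = A - theta I] for the shifted matrix, [L] for the spread
    [lam_max - lam_min], and take all vectors of one outer step.

    The idea is that the MINRES residual [xi d = S w - u] is orthogonal to [S v]
    for every [v] of the Krylov space ([minres_residual_orthogonal]: this is
    first-order optimality of a least squares problem).  Two choices of [v]
    suffice.

    The choice [v = u] gives [d^* S u = 0].  As [x] is an eigenvector of the
    Hermitian matrix [S], the components along [x] and along its orthogonal
    complement do not interact, and the equation becomes
      [sin phi sin psi |f^* S e| = cos phi |cos psi| |lam - theta|]
    ([orthogonality_relation]).  The Rayleigh quotient is accurate to second
    order, [|lam - theta| <= L sin^2 phi] ([rayleigh_error]), whereas [S] is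
    bounded below on the complement of [x],
    [norm2 (S e) >= |lam_2 - theta| > |lam_2 - lam| / 2]
    ([complement_shifted_ge]).  With the lower bound assumed on the angle between
    [f] and [S e], dividing by [sin phi] yields the bound on [sin psi].  The
    division is illegitimate when [sin phi = 0]; then [S u = 0], and optimality
    with respect to [v = w] forces [S w = 0], so that [d] is parallel to [u], hence
    to [x] ([residual_direction_at_eigenvector]).  The estimate on [|cos psi|]
    follows from [cos^2 + sin^2 = 1].

    The choice [v = w] also determines the sign: it gives [d^* u = - xi], that is,
      [cos phi cos psi + sin phi sin psi Re (e^* f) = - xi].
    If [cos psi] were nonnegative, this would force [xi <= sin phi]
    ([cos_residual_lt0]).  So [xi > sin phi] implies [cos psi < 0], and then
    [norm2 (d + x) ^ 2 = 2 (1 + cos psi)] is of the order of [sin^2 psi]. *)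

(** * Conjugation and the embedding of the reals *)

(** Simplification unfolds conjugation on [R[i]] to a concrete operation; these
    instances of the morphism laws, and those of the embedding below, rewrite
    without it. *)
Section Conjugation.
Variable (C : numClosedFieldType).
Implicit Types a b : C.

Lemma conjCD a b : (a + b)^*%R = a^*%R + b^*%R. Proof. exact: rmorphD. Qed.
Lemma conjCM a b : (a * b)^*%R = a^*%R * b^*%R. Proof. exact: rmorphM. Qed.
Lemma conjCN a : (- a)^*%R = - a^*%R. Proof. exact: rmorphN. Qed.
Lemma conjC_sum I (s : seq I) (F : I -> C) :
  (\sum_(i <- s) F i)^*%R = \sum_(i <- s) (F i)^*%R.
Proof. exact: rmorph_sum. Qed.

End Conjugation.

Lemma conjC_realC (R : realType) (t : R) : (t%:C)^*%R = t%:C :> R[i].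
Proof. exact: conjc_real. Qed.

Section RealEmbedding.
Variable (R : realType).
Implicit Types a b : R.

Lemma realCX a k : (a ^+ k)%:C = a%:C ^+ k :> R[i]. Proof. exact: rmorphXn. Qed.
Lemma realCM a b : (a * b)%:C = a%:C * b%:C :> R[i]. Proof. exact: rmorphM. Qed.
Lemma realCV a : (a^-1)%:C = (a%:C)^-1 :> R[i]. Proof. exact: fmorphV. Qed.
Lemma realCD a b : (a + b)%:C = a%:C + b%:C :> R[i]. Proof. exact: rmorphD. Qed.
Lemma realCB a b : (a - b)%:C = a%:C - b%:C :> R[i]. Proof. exact: rmorphB. Qed.

Lemma realC_neq0 a : a != 0 -> a%:C != 0 :> R[i].
Proof. by apply: contra_neq => -[]. Qed.

Lemma normC_realC a : `|a%:C| = `|a|%:C :> R[i].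
Proof. by rewrite normc_def /= expr0n addr0 sqrtr_sqr. Qed.

Lemma realC_Re_norm (z : R[i]) : (complex.Re `|z|)%:C = `|z|.
Proof. by rewrite RRe_real ?ger0_real. Qed.

End RealEmbedding.

(** * The unit circle *)

Section UnitCircle.
Variable (R : realType).
Implicit Types c s : R.

Lemma unit_circle_norm_le1 c s : c ^+ 2 + s ^+ 2 = 1 -> `|c| <= 1.
Proof.
move=> cs; rewrite -(@ler_pXn2r _ 2) ?nnegrE // real_normK ?num_real //.
by rewrite expr1n -cs lerDl sqr_ge0.
Qed.

(** For [0 <= c], [1 - c <= (1 - c) * (1 + c) = s ^ 2]. *)
Lemma unit_circle_near1 c s a : c ^+ 2 + s ^+ 2 = 1 -> 0 <= c ->
  0 <= s -> s <= a -> `|c - 1| <= a ^+ 2.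
Proof.
move=> cs c0 s0 sa.
have c1 : c <= 1 := le_trans (ler_norm c) (unit_circle_norm_le1 cs).
have : s ^+ 2 <= a ^+ 2 by rewrite lerXn2r ?nnegrE // (le_trans s0).
rewrite distrC ger0_norm ?subr_ge0 //; nra.
Qed.

End UnitCircle.

(** * The Hermitian inner product *)

Section InnerProduct.
Variables (R : realType) (n : nat).
Implicit Types (u v w g r : 'cV[R[i]]_n) (a : R[i]).

Lemma cdotDr u v w : cdot u (v + w) = cdot u v + cdot u w.
Proof. by rewrite /cdot mulmxDr mxE. Qed.

Lemma cdotZr u a v : cdot u (a *: v) = a * cdot u v.
Proof. by rewrite /cdot -scalemxAr mxE. Qed.

Lemma cdotC u v : cdot u v = (cdot v u)^*%R.
Proof.
rewrite /cdot !mxE conjC_sum; apply: eq_bigr => i _.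
by rewrite !mxE conjCM conjCK mulrC.
Qed.

Lemma cdotDl u v w : cdot (u + v) w = cdot u w + cdot v w.
Proof. by rewrite cdotC cdotDr conjCD -!cdotC. Qed.

Lemma cdotZl a u v : cdot (a *: u) v = a^*%R * cdot u v.
Proof. by rewrite cdotC cdotZr conjCM -cdotC. Qed.

Lemma cdot_norm2 v : cdot v v = (norm2 v ^+ 2)%:C.
Proof.
have h : 0 <= cdot v v.
  rewrite /cdot !mxE sumr_ge0 // => i _.
  by rewrite !mxE mulrC mul_conjC_ge0.
rewrite /norm2 sqr_sqrtr; first by rewrite RRe_real ?ger0_real.
by move: h; rewrite lecE => /andP[].
Qed.

Lemma norm2_ge0 v : 0 <= norm2 v.
Proof. exact: sqrtr_ge0. Qed.

Lemma norm2_eq0 v : norm2 v = 0 -> v = 0.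
Proof.
move=> v0; have := cdot_norm2 v; rewrite v0 expr0n /= /cdot mxE => /eqP.
rewrite psumr_eq0 => [/allP h|i _]; last by rewrite !mxE mulrC mul_conjC_ge0.
apply/matrixP => i j; rewrite ord1 mxE.
have := h i (mem_index_enum _); rewrite !mxE /= mulrC mul_conjC_eq0.
by move/eqP.
Qed.

Lemma norm2Z a v : (norm2 (a *: v))%:C = `|a| * (norm2 v)%:C.
Proof.
apply/eqP; rewrite -(@eqrXn2 _ 2) ?mulr_ge0 ?normr_ge0 ?ler0c ?norm2_ge0 //.
apply/eqP; rewrite exprMn normCK -!realCX.
by rewrite -!cdot_norm2 cdotZl cdotZr; ring.
Qed.

(** Pythagoras for the component of [r] orthogonal to [g]; both the Cauchy-Schwarz
    inequality and the optimality condition below come from this identity. *)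
Lemma norm2_sub_proj g r : norm2 g != 0 ->
  (norm2 (r - (cdot g r * (norm2 g ^- 2)%:C) *: g) ^+ 2)%:C =
  (norm2 r ^+ 2)%:C - `|cdot g r| ^+ 2 * (norm2 g ^- 2)%:C.
Proof.
move=> g0; rewrite -!cdot_norm2 -scaleNr.
have g1 : (norm2 g ^- 2)%:C * (norm2 g ^+ 2)%:C = 1 :> R[i].
  by rewrite -realCM mulVf ?rmorph1 // expf_eq0.
rewrite !(cdotDl, cdotDr, cdotZl, cdotZr) (cdotC r g) normCK.
rewrite conjCN conjCM -cdotC (cdot_norm2 g) conjC_realC.
rewrite (cdotC r g).
set t := (norm2 g ^- 2)%:C in g1 *; set q := (norm2 g ^+ 2)%:C in g1 *.
set z := cdot g r.
have -> : - (z^*%R * t) * (- (z * t) * q) = z * z^*%R * t * (t * q) by ring.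
by rewrite g1; ring.
Qed.

Lemma cauchy_schwarz v w : `|cdot v w| <= (norm2 v * norm2 w)%:C.
Proof.
have [v0|v0] := eqVneq (norm2 v) 0.
  have -> : cdot v w = 0.
    by rewrite (norm2_eq0 v0) -(scale0r w) cdotZl conjC0 mul0r.
  by rewrite normr0 v0 mul0r.
have h : `|cdot v w| ^+ 2 * (norm2 v ^- 2)%:C <= (norm2 w ^+ 2)%:C.
  by rewrite -subr_ge0 -norm2_sub_proj // ler0c sqr_ge0.
rewrite -(@ler_pXn2r _ 2) ?nnegrE ?normr_ge0 ?ler0c ?mulr_ge0 ?norm2_ge0 //.
have -> : (norm2 v * norm2 w)%:C ^+ 2 =
    (norm2 v ^+ 2)%:C * (norm2 w ^+ 2)%:C :> R[i].
  by rewrite -realCX exprMn realCM.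
rewrite mulrC -ler_pdivrMr; first by rewrite -realCV.
by rewrite ltcR exprn_gt0 // lt_def v0 norm2_ge0.
Qed.

Lemma norm2_decomposition (x y e : 'cV[R[i]]_n) (c s : R) :
  c ^+ 2 + s ^+ 2 = 1 -> norm2 x = 1 -> cdot x e = 0 -> norm2 e = 1 ->
  y = c%:C *: x + s%:C *: e ->
  norm2 y = 1.
Proof.
move=> cs x1 xe e1 ->; apply/eqP.
rewrite -(@pexpr_eq1 _ _ 2) ?norm2_ge0 //; apply/eqP/complexI.
rewrite -cdot_norm2 !(cdotDl, cdotDr, cdotZl, cdotZr) (cdotC e x) xe conjC0.
rewrite !cdot_norm2 e1 x1 !conjC_realC !mulr0 addr0 add0r expr1n !mulr1.
by rewrite -!realCM -!expr2 -realCD cs.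
Qed.

Lemma cauchy_schwarz_Re_norm v w : complex.Re `|cdot v w| <= norm2 v * norm2 w.
Proof. by rewrite -lecR realC_Re_norm cauchy_schwarz. Qed.

Lemma cauchy_schwarz_Re v w : `|complex.Re (cdot v w)| <= norm2 v * norm2 w.
Proof. by rewrite -lecR (le_trans (normc_ge_Re _)) ?cauchy_schwarz. Qed.

(** With the convention [0^-1 = 0] this covers null vectors, so that the angles
    are arc cosines of numbers in [[-1, 1]] whatever the vectors. *)
Lemma ratio_range (a b : R) : 0 <= b -> `|a| <= b -> -1 <= a / b <= 1.
Proof.
rewrite le_eqVlt => /predU1P[<-|b0 ab]; first by
  rewrite invr0 mulr0 lerN10 ler01.
by rewrite -ler_norml normrM normfV (gtr0_norm b0) ler_pdivrMr ?mul1r.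
Qed.

Lemma acute_ratio_range v w :
  -1 <= complex.Re `|cdot v w| / (norm2 v * norm2 w) <= 1.
Proof.
rewrite ratio_range ?mulr_ge0 ?norm2_ge0 // ger0_norm.
  exact: cauchy_schwarz_Re_norm.
by rewrite -ler0c realC_Re_norm normr_ge0.
Qed.

Lemma cos_acute_angle v w :
  cos (acute_angle v w) = complex.Re `|cdot v w| / (norm2 v * norm2 w).
Proof. by have [] := acos_def (acute_ratio_range v w). Qed.

Lemma cos_acute_angle_ge0 v w : 0 <= cos (acute_angle v w).
Proof.
rewrite cos_acute_angle mulr_ge0 ?invr_ge0 ?mulr_ge0 ?norm2_ge0 //.
by rewrite -ler0c realC_Re_norm normr_ge0.
Qed.

Lemma sin_acute_angle_ge0 v w : 0 <= sin (acute_angle v w).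
Proof.
by have [h _] := acos_def (acute_ratio_range v w); exact: sin_ge0_pi.
Qed.

Lemma sin_angle_ge0 v w : 0 <= sin (angle v w).
Proof.
have [|h _] := @acos_def _ (complex.Re (cdot v w) / (norm2 v * norm2 w)).
  by rewrite ratio_range ?mulr_ge0 ?norm2_ge0 ?cauchy_schwarz_Re.
exact: sin_ge0_pi.
Qed.

(** Testing with the projection coefficient [t = cdot g r / norm2 g ^ 2] would
    decrease the norm strictly unless [cdot g r] vanishes. *)
Lemma best_approximation_orthogonal g r :
  (forall t, norm2 r <= norm2 (r - t *: g)) -> cdot g r = 0.
Proof.
move=> h; have [g0|g0] := eqVneq (norm2 g) 0.
  by rewrite (norm2_eq0 g0) -(scale0r r) cdotZl conjC0 mul0r.
have := h (cdot g r * (norm2 g ^- 2)%:C).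
rewrite -(@ler_pXn2r _ 2) ?nnegrE ?norm2_ge0 // -lecR norm2_sub_proj // lerDl.
rewrite oppr_ge0 => h1.
have g1 : 0 < (norm2 g ^- 2)%:C :> R[i].
  by rewrite ltcR invr_gt0 exprn_gt0 // lt_def g0 norm2_ge0.
move: h1; rewrite pmulr_lle0 // => h1.
by apply/eqP; rewrite -normr_eq0 -sqrf_eq0 eq_le h1 exprn_ge0 ?normr_ge0.
Qed.

End InnerProduct.

(** * Spectral estimates *)

Section EigenExpansion.
Local Open Scope sesquilinear_scope.
Variables (R : realType) (n : nat) (A : 'M[R[i]]_n.+2).
Variables (lam : 'I_n.+2 -> R) (X : 'I_n.+2 -> 'cV[R[i]]_n.+2).
Hypotheses (hA : A \is hermsymmx) (hX : orthonormal_eigenbasis A lam X).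
Implicit Types v w : 'cV[R[i]]_n.+2.

Lemma cdot_shifted_l t v w :
  cdot v (shifted A t *m w) = cdot (shifted A t *m v) w.
Proof.
have hS : (shifted A t)^t* = shifted A t.
  apply/matrixP => i j.
  move: hA; rewrite is_hermitianmxE expr0 scale1r => /eqP AA.
  have Aij : A i j = (A j i)^*%R by rewrite {1}AA !mxE.
  rewrite !mxE Aij conjCD conjCN [j == i]eq_sym; congr (_ - _).
  by case: (i == j); rewrite ?mulr1n ?mulr0n ?conjC_realC ?conjC0.
by rewrite /cdot trmx_mul map_mxM /= hS mulmxA.
Qed.

Lemma shifted_eigenvector t i : shifted A t *m X i = (lam i - t)%:C *: X i.
Proof.
have [eigX _] := hX.
by rewrite /shifted mulmxBl eigX mul_scalar_mx -scalerBl realCB.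
Qed.

(** The matrix [Q] with columns [X i] satisfies [Q^* Q = 1], hence [Q Q^* = 1]
    because it is square; inserting the latter into [v^* w] is the expansion. *)
Lemma parseval v w : cdot v w = \sum_i (cdot (X i) v)^*%R * cdot (X i) w.
Proof.
pose Q := \matrix_(i, j) X j i 0.
have QQ : Q *m Q^t* = 1%:M.
  apply: mulmx1C; apply/matrixP => i j; have [_ /(_ i j)] := hX.
  rewrite !mxE => <-; rewrite /cdot mxE; apply: eq_bigr => k _.
  by rewrite !mxE.
rewrite /cdot -[v^t*]mulmx1 -QQ mulmxA -mulmxA mxE; apply: eq_bigr => i _.
congr (_ * _); rewrite !mxE.
  rewrite conjC_sum; apply: eq_bigr => k _.
  by rewrite !mxE conjCM conjCK mulrC.
by apply: eq_bigr => k _; rewrite !mxE.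
Qed.

Lemma cdot_eigenvector_shifted t i v :
  cdot (X i) (shifted A t *m v) = (lam i - t)%:C * cdot (X i) v.
Proof. by rewrite cdot_shifted_l shifted_eigenvector cdotZl conjC_realC. Qed.

Lemma norm2_expansion v : (norm2 v ^+ 2)%:C = \sum_i `|cdot (X i) v| ^+ 2.
Proof.
by rewrite -cdot_norm2 parseval; apply: eq_bigr => i _; rewrite normCK mulrC.
Qed.

Lemma norm2_shifted_expansion t v :
  (norm2 (shifted A t *m v) ^+ 2)%:C =
  \sum_i ((lam i - t) ^+ 2)%:C * `|cdot (X i) v| ^+ 2.
Proof.
rewrite norm2_expansion; apply: eq_bigr => i _.
rewrite cdot_eigenvector_shifted !normCK conjCM conjC_realC realCX; ring.
Qed.

Lemma norm2_shifted_ge t (a : R) v : 0 <= a ->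
  (forall i, cdot (X i) v != 0 -> a <= `|lam i - t|) ->
  a * norm2 v <= norm2 (shifted A t *m v).
Proof.
move=> a0 ha; rewrite -(@ler_pXn2r _ 2) ?nnegrE ?mulr_ge0 ?norm2_ge0 //.
rewrite exprMn -lecR (realCM (a ^+ 2)).
rewrite norm2_shifted_expansion norm2_expansion mulr_sumr.
apply: ler_sum => i _; have [->|c0] := eqVneq (cdot (X i) v) 0.
  by rewrite normr0 expr0n !mulr0.
rewrite ler_wpM2r ?exprn_ge0 ?normr_ge0 // lecR -[leRHS]real_normK ?num_real //.
by rewrite lerXn2r ?nnegrE ?normr_ge0 // ha.
Qed.

Lemma norm2_shifted_le t (a : R) v : 0 <= a -> (forall i, `|lam i - t| <= a) ->
  norm2 (shifted A t *m v) <= a * norm2 v.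
Proof.
move=> a0 ha; rewrite -(@ler_pXn2r _ 2) ?nnegrE ?mulr_ge0 ?norm2_ge0 //.
rewrite exprMn -lecR (realCM (a ^+ 2)).
rewrite norm2_shifted_expansion norm2_expansion mulr_sumr.
apply: ler_sum => i _.
rewrite ler_wpM2r ?exprn_ge0 ?normr_ge0 // lecR -[leLHS]real_normK ?num_real //.
by rewrite lerXn2r ?nnegrE ?normr_ge0 // ha.
Qed.

Lemma eigenvalue_distance_le i :
  `|lam i - lam ord0| <= lam_max lam - lam_min lam.
Proof.
have hM j : lam j <= lam_max lam by exact: le_bigmax.
have hm j : lam_min lam <= lam j by exact: bigmin_le.
have := hM i; have := hM ord0; have := hm i; have := hm ord0.
by rewrite ler_norml; lra.
Qed.

Lemma unimodular_eigenvector t (z : R[i]) :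
  shifted A t *m (z *: X ord0) = (lam ord0 - t)%:C *: (z *: X ord0).
Proof. by rewrite -scalemxAr shifted_eigenvector !scalerA mulrC. Qed.

Lemma norm2_unimodular_eigenvector (z : R[i]) :
  `|z| = 1 -> norm2 (z *: X ord0) = 1.
Proof.
have [_ X1] := hX.
have := X1 ord0 ord0; rewrite cdot_norm2 eqxx.
move=> /complexI /eqP; rewrite pexpr_eq1 ?norm2_ge0 // => /eqP X0 z1.
by apply: complexI; rewrite norm2Z X0 z1 mul1r.
Qed.

(** Only the eigenvalues other than the target contribute to a vector orthogonal
    to the target eigenvector, and of these [lam_2] is nearest to [theta].  As
    [theta] is closer to [lam] than half of the gap, its distance to [lam_2]
    exceeds half of the gap. *)
Lemma complement_shifted_ge theta (e : 'cV[R[i]]_n.+2) :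
  good_approximation lam theta -> cdot (X ord0) e = 0 -> norm2 e = 1 ->
  `|lam (ord_second n) - lam ord0| / 2 <= norm2 (shifted A theta *m e).
Proof.
move=> [_ mono near] X0e e1.
apply: le_trans (_ : `|lam (ord_second n) - theta| <= _).
  have := ler_distD theta (lam (ord_second n)) (lam ord0).
  move: near; rewrite (distrC theta) (distrC (lam ord0) (lam _)); lra.
rewrite -[leLHS]mulr1 -e1 norm2_shifted_ge // => i.
have [i0|i0 _] := posnP i; last exact: mono.
by rewrite (_ : i = ord0) ?X0e ?eqxx //; exact: val_inj.
Qed.

(** [theta - lam = u^* (A - lam I) u], and [A - lam I] kills the component of [u]
    along [x] on either side, which leaves [s ^ 2 * e^* (A - lam I) e]. *)
Lemma rayleigh_error (x u e : 'cV[R[i]]_n.+2) (c s : R) :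
  shifted A (lam ord0) *m x = 0 -> norm2 u = 1 -> norm2 e = 1 ->
  u = c%:C *: x + s%:C *: e ->
  `|rayleigh A u - lam ord0| <= (lam_max lam - lam_min lam) * s ^+ 2.
Proof.
move=> Sx u1 e1 ue; set L := _ - lam_min _.
have L0 : 0 <= L.
  by apply: le_trans (eigenvalue_distance_le ord0); exact: normr_ge0.
have Su : shifted A (lam ord0) *m u = s%:C *: (shifted A (lam ord0) *m e).
  by rewrite ue mulmxDr -!scalemxAr Sx scaler0 add0r.
have -> : rayleigh A u - lam ord0 =
    s ^+ 2 * complex.Re (cdot (shifted A (lam ord0) *m e) e).
  have -> : rayleigh A u - lam ord0 =
      complex.Re (cdot u (shifted A (lam ord0) *m u)).
    rewrite /shifted mulmxBl mul_scalar_mx -scaleNr cdotDr cdotZr cdot_norm2 u1.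
    by rewrite expr1n mulr1 /rayleigh; case: (cdot u _).
  rewrite Su cdotZr cdot_shifted_l Su cdotZl conjC_realC mulrA -realCM.
  by case: (cdot _ _) => a b /=; ring.
rewrite normrM ger0_norm ?sqr_ge0 // mulrC ler_wpM2r ?sqr_ge0 //.
rewrite (le_trans (cauchy_schwarz_Re _ _)) // e1 mulr1 -[L]mulr1 -e1.
by rewrite norm2_shifted_le // => i; exact: eigenvalue_distance_le.
Qed.

End EigenExpansion.

(** * Optimality of the MINRES iterate *)

Section MinresResidual.
Variables (R : realType) (n : nat) (A : 'M[R[i]]_n.+2).
Implicit Types u v w : 'cV[R[i]]_n.+2.

Lemma start_in_krylov m u : (0 < m)%N -> u \in krylov m A u.
Proof.
move=> m0; rewrite memv_span //.
by apply/mapP; exists 0%N; rewrite ?mem_iota // expr0 mul1mx.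
Qed.

(** Moving from [w] along [- t v] stays in the Krylov space and changes the
    residual by a multiple of [S v]. *)
Lemma minres_residual_orthogonal theta u m w v :
  minres_solution A theta u m w -> v \in krylov m A u ->
  cdot (shifted A theta *m v) (shifted A theta *m w - u) = 0.
Proof.
move=> [wK wmin] vK; apply: best_approximation_orthogonal => t.
rewrite addrAC scalemxAr -mulmxBr; apply: wmin.
by rewrite rpredB // rpredZ.
Qed.

End MinresResidual.

(** * One outer step *)

(** Here [c], [s], [c'] and [s'] stand for the cosine and the sine of [phi] and
    of [psi], of which only the Pythagorean relation and the signs matter. *)
Section OneStep.
Variables (R : realType) (n : nat) (A : 'M[R[i]]_n.+2) (lam0 theta : R).
Variables (x u d e f w : 'cV[R[i]]_n.+2) (c s c' s' xi : R).
Hypothesis hA : A \is hermsymmx.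
Hypothesis Sx : shifted A theta *m x = (lam0 - theta)%:C *: x.
Hypotheses (x1 : norm2 x = 1) (xe : cdot x e = 0) (xf : cdot x f = 0).
Hypotheses (e1 : norm2 e = 1) (f1 : norm2 f = 1).
Hypotheses (ue : u = c%:C *: x + s%:C *: e) (df : d = c'%:C *: x + s'%:C *: f).
Hypotheses (cs : c ^+ 2 + s ^+ 2 = 1) (cs' : c' ^+ 2 + s' ^+ 2 = 1).
Hypotheses (c0 : 0 <= c) (s0 : 0 <= s) (s'0 : 0 <= s').
Hypotheses (xi0 : 0 < xi) (Sw : shifted A theta *m w = u + xi%:C *: d).
Local Notation S := (shifted A theta).
Hypothesis Su_r : cdot (S *m u) (xi%:C *: d) = 0.
Hypothesis Sw_r : cdot (S *m w) (xi%:C *: d) = 0.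

Let xiC : xi%:C != 0 :> R[i]. Proof. by rewrite realC_neq0 ?gt_eqF. Qed.

Lemma shifted_start_direction_orthogonal : cdot (S *m u) d = 0.
Proof. by move/eqP: Su_r; rewrite cdotZr mulf_eq0 (negPf xiC) => /eqP. Qed.

(** This is [cdot (S u) d = 0] in the decompositions along [x]: the cross terms
    vanish because [S] maps [x] to a multiple of itself and, being Hermitian,
    preserves the orthogonal complement of [x]. *)
Lemma orthogonality_relation :
  s * s' * complex.Re `|cdot f (S *m e)| = c * `|c'| * `|lam0 - theta|.
Proof.
have ex : cdot e x = 0 by rewrite cdotC xe conjC0.
have Sex : cdot (S *m e) x = 0 by rewrite -cdot_shifted_l // Sx cdotZr ex mulr0.
have := shifted_start_direction_orthogonal.
rewrite ue df mulmxDr -!scalemxAr Sx.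
rewrite !(cdotDl, cdotDr, cdotZl, cdotZr) Sex xf cdot_norm2 x1 expr1n.
rewrite !conjC_realC !mulr0 addr0 add0r mulr1 => /eqP.
rewrite addr_eq0 => /eqP /(congr1 Num.norm).
rewrite normrN !normrM !normC_realC (cdotC (S *m e)) norm_conjC -realC_Re_norm.
rewrite -!realCM => /complexI.
rewrite !(ger0_norm c0, ger0_norm s0, ger0_norm s'0).
by move=> /= h; lra.
Qed.

(** In this case [S u = 0], and [norm2 (S w) ^ 2 = cdot (S w) u = cdot w (S u)]
    by optimality and symmetry of [S]; thus [u + xi d = S w = 0]. *)
Lemma residual_direction_at_eigenvector : s = 0 -> lam0 = theta -> s' = 0.
Proof.
move=> s_0 lt.
have ux : u = c%:C *: x by rewrite ue s_0 scale0r addr0.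
have Su0 : S *m u = 0 by rewrite ux -scalemxAr Sx lt subrr scale0r scaler0.
have Sw0 : S *m w = 0.
  apply: norm2_eq0; apply/eqP; rewrite -sqrf_eq0; apply/eqP/complexI.
  rewrite -cdot_norm2 {2}Sw cdotDr Sw_r addr0 -cdot_shifted_l // Su0.
  by rewrite -(scale0r x) cdotZr mul0r.
have := congr1 (cdot f) Sw; rewrite Sw0 ux df !(cdotDr, cdotZr).
rewrite (cdotC f x) xf conjC0 !mulr0 cdot_norm2 f1 expr1n mulr1 !add0r.
rewrite -(scale0r x) cdotZr mul0r -realCM => /complexI/esym/eqP.
by rewrite mulf_eq0 gt_eqF //= => /eqP.
Qed.

(** The relation above is of the form [s * s' * const <= L * s ^ 2], where one
    factor [s] cancels.  In the application [g] is the gap [|lam_2 - lam|] and [k]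
    the uniform lower bound on the cosine of the angle between [f] and [S e]. *)
Lemma sin_residual_le (L g k : R) : 0 <= L -> 0 < g -> 0 < k ->
  `|lam0 - theta| <= L * s ^+ 2 -> g / 2 <= norm2 (S *m e) ->
  k * norm2 (S *m e) <= complex.Re `|cdot f (S *m e)| ->
  s' <= 2 * (L / g) / k * s.
Proof.
move=> L0 g0 k0 err Se cosf.
have -> : 2 * (L / g) / k * s = (2 * L * s) / (g * k).
  by field; rewrite !gt_eqF.
rewrite ler_pdivlMr ?mulr_gt0 //.
have [s_0|s_neq0] := eqVneq s 0.
  rewrite residual_direction_at_eigenvector ?s_0 ?mul0r ?mulr0 //.
  move: err; rewrite s_0 expr0n mulr0 normr_le0 subr_eq0.
  by move/eqP.
have s_gt0 : 0 < s by rewrite lt_def s_neq0.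
have c1 : c <= 1 := le_trans (ler_norm c) (unit_circle_norm_le1 cs).
have c'1 : `|c'| <= 1 := unit_circle_norm_le1 cs'.
have fSe : k * (g / 2) <= complex.Re `|cdot f (S *m e)|.
  by apply: le_trans cosf; rewrite ler_wpM2l // ltW.
have cc : c * `|c'| * `|lam0 - theta| <= L * s ^+ 2.
  apply: le_trans err; rewrite -[leRHS]mul1r ler_wpM2r //.
  by rewrite mulr_ile1.
have h : s * s' * (k * (g / 2)) <= L * s ^+ 2.
  apply: le_trans cc; rewrite -orthogonality_relation ler_wpM2l //.
  exact: mulr_ge0.
rewrite -(ler_pM2l s_gt0); lra.
Qed.

(** As [S w = u + xi d] is orthogonal to [d], [cdot u d = - xi].  The part of
    [cdot u d] coming from [e] and [f] is at least [- s], so if [c'] were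
    nonnegative the residual norm could not exceed [s]. *)
Lemma cos_residual_lt0 : norm2 d = 1 -> s < xi -> c' < 0.
Proof.
move=> d1 sxi; rewrite ltNge; apply/negP => c'0.
have ex : cdot e x = 0 by rewrite cdotC xe conjC0.
have := Sw_r; rewrite cdotZr => /eqP; rewrite mulf_eq0 (negPf xiC) /=.
rewrite Sw cdotDl cdotZl conjC_realC cdot_norm2 d1 expr1n mulr1 ue df.
rewrite !(cdotDl, cdotDr, cdotZl, cdotZr) ex xf cdot_norm2 x1 expr1n.
rewrite !conjC_realC !mulr0 addr0 add0r mulr1 -!realCM => /eqP.
move=> /(congr1 (@complex.Re R)).
have := cauchy_schwarz_Re e f; rewrite e1 f1 mulr1 ler_norml.
case: (cdot e f) => a b /= /andP[a1 _] h.
have s'1 : s' <= 1.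
  apply: le_trans (ler_norm _) (@unit_circle_norm_le1 _ s' c' _).
  by rewrite addrC.
have cc' : 0 <= c' * c by rewrite mulr_ge0.
have ss'a : 0 <= s * s' * (a + 1) by rewrite !mulr_ge0 //; lra.
have ss' : 0 <= s * (1 - s') by rewrite mulr_ge0 // subr_ge0.
lra.
Qed.

(** For [c' <= 0],
    [norm2 (d + x) ^ 2 = 2 (1 + c') <= 2 (1 + c') (1 - c') = 2 s' ^ 2]. *)
Lemma norm2_add_direction : c' <= 0 -> norm2 (d + x) <= 2 * s'.
Proof.
move=> c'0; rewrite -(@ler_pXn2r _ 2) ?nnegrE ?mulr_ge0 ?norm2_ge0 //.
have dx : d + x = (c' + 1)%:C *: x + s'%:C *: f.
  by rewrite df addrAC realCD scalerDl scale1r.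
have fx : cdot f x = 0 by rewrite cdotC xf conjC0.
rewrite -lecR -cdot_norm2 dx !(cdotDl, cdotDr, cdotZl, cdotZr) fx xf.
rewrite !cdot_norm2 x1 f1 !conjC_realC !mulr0 addr0 add0r expr1n !mulr1.
rewrite -!realCM -realCD lecR.
have c'1 : 0 <= c' + 1.
  by have := unit_circle_norm_le1 cs'; rewrite ler_norml; lra.
have : 0 <= (c' + 1) * - c' by rewrite mulr_ge0 ?oppr_ge0.
move: cs'; rewrite exprMn; lra.
Qed.

End OneStep.

(** * Convergence of the residual direction *)

(* K is the set of outer steps under consideration. z k is the unimodular factor
   normalizing the eigenvector X ord0, which is determined only up to phase, so
   that u k and d k have real coefficients along x k := z k *: X ord0, that of
   u k being nonnegative. The sign of this coefficient of w k / norm2 (w k)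
   changes from one step to the next in general, so a single z would not do. *)
Theorem theorem4 (R : realType) (n : nat) (A : 'M[R[i]]_n.+2)
    (lam : 'I_n.+2 -> R) (X : 'I_n.+2 -> 'cV[R[i]]_n.+2) (m : nat) (vphi : R)
    (hA : A \is hermsymmx) (hX : orthonormal_eigenbasis A lam X)
    (hm : (1 < m)%N) (hvphi : 0 < `|cos vphi|) :
  exists C delta : R, [/\ 0 < C, 0 < delta &
    forall (u w d e f : nat -> 'cV[R[i]]_n.+2) (xi : nat -> R) (z : nat -> R[i])
           (K : set nat),
    let theta k := rayleigh A (u k) in
    let x k := z k *: X ord0 in
    let phi k := acute_angle (u k) (x k) in
    let psi k := angle (d k) (x k) in
    inexact_rqi_minres A m u w ->
    (forall k, K k ->
      [/\ good_approximation lam (theta k),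
          minres_residual A (theta k) (u k) (w k) (xi k) (d k),
          `|z k| = 1,
          orthogonal_decomposition (x k) (u k) (phi k) (e k)
        & orthogonal_decomposition (x k) (d k) (psi k) (f k)]) ->
    (forall k, K k ->
      `|cos vphi|
        <= `|cos (acute_angle (f k) (shifted A (theta k) *m e k))|) ->
    forall k, K k ->
      [/\ sin (psi k) <= 2 * spread_ratio lam / `|cos vphi| * sin (phi k),
          sin (phi k) < delta ->
            `|cos (psi k) - 1| <= C * sin (phi k) ^+ 2 \/
            `|cos (psi k) + 1| <= C * sin (phi k) ^+ 2
        & sin (phi k) < xi k -> sin (phi k) < delta ->
            `|cos (psi k) + 1| <= C * sin (phi k) ^+ 2 /\
            norm2 (d k + x k) <= C * sin (phi k)]].
Proof.
pose B := 2 * spread_ratio lam / `|cos vphi|.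
(* The estimates are uniform in [phi k]; 1 is a bound for any sine. *)
exists (1 + 2 * `|B| + `|B| ^+ 2), 1.
have B0 : 0 <= `|B| := normr_ge0 B.
split=> // [|u w d e f xi z K theta x phi psi rqi dec ang k Kk].
  by have := sqr_ge0 `|B|; lra.
have [good [d1 xi0 Sw] z1 [xe e1 ue] [xf f1 df]] := dec k Kk.
have x1 := norm2_unimodular_eigenvector hX z1.
have Sx := unimodular_eigenvector hX (theta k) (z k).
rewrite -/(x k) in x1 Sx.
have [_ /(_ k) [sol _]] := rqi.
have r_d : shifted A (theta k) *m w k - u k = (xi k)%:C *: d k.
  by rewrite Sw addrC addKr.
have orth v : v \in krylov m A (u k) ->
    cdot (shifted A (theta k) *m v) ((xi k)%:C *: d k) = 0.
  by move=> vK; rewrite -r_d (minres_residual_orthogonal sol).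
have Sw_r := orth _ sol.1.
have Su_r := orth _ (start_in_krylov A (u k) (ltnW hm)).
have cs := cos2Dsin2 (phi k).
have cs' := cos2Dsin2 (psi k).
have c0 : 0 <= cos (phi k) := cos_acute_angle_ge0 _ _.
have s0 : 0 <= sin (phi k) := sin_acute_angle_ge0 _ _.
have s'0 : 0 <= sin (psi k) := sin_angle_ge0 _ _.
have u1 := norm2_decomposition cs x1 xe e1 ue.
have X0e : cdot (X ord0) (e k) = 0.
  have z0 : z k != 0 by rewrite -normr_eq0 z1 oner_eq0.
  by move/eqP: xe; rewrite /x cdotZl mulf_eq0 conjC_eq0 (negPf z0) => /eqP.
have Se := complement_shifted_ge hA hX good X0e e1.
have gap : 0 < `|lam (ord_second n) - lam ord0|.
  case: good => _ _; rewrite (distrC (lam ord0) (lam _)).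
  by move=> /(le_lt_trans (normr_ge0 _)) h; lra.
have L0 : 0 <= lam_max lam - lam_min lam.
  by apply: le_trans (eigenvalue_distance_le lam ord0); exact: normr_ge0.
have err : `|lam ord0 - theta k| <=
    (lam_max lam - lam_min lam) * sin (phi k) ^+ 2.
  rewrite distrC; apply: (rayleigh_error hA hX _ u1 e1 ue).
  by rewrite (unimodular_eigenvector hX) subrr scale0r.
have fSe : `|cos vphi| * norm2 (shifted A (theta k) *m e k) <=
    complex.Re `|cdot (f k) (shifted A (theta k) *m e k)|.
  have Se0 : 0 < norm2 (shifted A (theta k) *m e k).
    by apply: lt_le_trans Se; rewrite divr_gt0.
  rewrite -ler_pdivlMr //; apply: le_trans (ang k Kk) _.
  by rewrite ger0_norm ?cos_acute_angle_ge0 // cos_acute_angle f1 mul1r.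
have sinB : sin (psi k) <= B * sin (phi k).
  exact: (sin_residual_le hA Sx x1 xe xf f1 ue df cs cs' c0 s0 s'0 xi0 Sw).
have sinB' : sin (psi k) <= `|B| * sin (phi k).
  by apply: le_trans sinB _; rewrite ler_wpM2r // ler_norm.
(* The summand [2 * `|B|] of the constant serves the bound on [d + x], the
   summand [`|B| ^+ 2] the bounds on the cosine; 1 makes it positive. *)
have BC : (`|B| * sin (phi k)) ^+ 2 <=
    (1 + 2 * `|B| + `|B| ^+ 2) * sin (phi k) ^+ 2.
  by rewrite exprMn ler_wpM2r ?sqr_ge0 // lerDr; lra.
have cosN : cos (psi k) <= 0 ->
    `|cos (psi k) + 1| <= (1 + 2 * `|B| + `|B| ^+ 2) * sin (phi k) ^+ 2.
  move=> c'0; apply: le_trans BC; rewrite -normrN opprD.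
  by apply: unit_circle_near1 s'0 sinB'; rewrite ?sqrrN ?oppr_ge0.
split=> // [_|sxi _].
  have [c'0|/ltW c'0] := lerP 0 (cos (psi k)); [left|right]; last exact: cosN.
  by apply: le_trans BC; exact: unit_circle_near1 s'0 sinB'.
have /ltW c'0 : cos (psi k) < 0.
  exact: (cos_residual_lt0 x1 xe xf e1 f1 ue df cs' c0 s0 s'0 xi0 Sw).
split; first exact: cosN.
apply: le_trans (norm2_add_direction x1 xf f1 df cs' s'0 c'0) _.
apply: le_trans (_ : 2 * (`|B| * sin (phi k)) <= _); first by rewrite ler_pM2l.
rewrite mulrA ler_wpM2r //; have := sqr_ge0 `|B|; lra.
Qed.
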